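(* Let $(I,\le)$ be a directed set and let $(f_\alpha)_{\alpha\in I}$ be a net of convex functions $f_\alpha:\mathbb{R}\to\mathbb{R}$ that converges pointwise on $\mathbb{R}$ to a function $f$. Then: (1) If $f_\alpha\in S$ for all $\alpha\in I$ and $f\in S$, then $\liminf_\alpha \sigma(f_\alpha)\ge\sigma(f)$. (2) If $f_\alpha\in S'$ for all $\alpha\in I$ and $f\in S'$, then $\limsup_\alpha \tau(f_\alpha)\le\tau(f)$. (3) If $f_\alpha\in S\cap S'$ for all $\alpha\in I$ and $f\in S_u$, then $\lim_\alpha\sigma(f_\alpha)=\sigma(f)$ and $\lim_\alpha\tau(f_\alpha)=\tau(f)$, where $\sigma(f)=\tau(f)$.
   Context: $C$ is the set of all convex functions $f:\mathbb{R}\to\mathbb{R}$; $A(f)=\{t\in\mathbb{R}: f(t)=\inf_{s\in\mathbb{R}} f(s)\}$. $S=\{f\in C: A(f)\neq\emptyset,\ \inf A(f)>-\infty\}$, $S'=\{f\in C: A(f)\ne\emptyset,\ \sup A(f)<\infty\}$, and $S_u=\{f\in C: f\text{ has a unique minimizing point}\}$. $\sigma(f)=\min A(f)$ for $f\in S$ and $\tau(f)=\max A(f)$ for $f\in S'$. For a real net, $\liminf_\alpha y_\alpha=\sup_{\alpha}\inf_{\beta\ge\alpha}y_\beta$ and $\limsup_\alpha y_\alpha=\inf_\alpha\sup_{\beta\ge\alpha}y_\beta$, taken in $[-\infty,\infty]$. *)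

(* Defs.v *)
From HB Require Import structures.
From mathcomp Require Import all_boot all_order all_algebra.
From mathcomp Require Import all_classical all_reals all_analysis.

Set Implicit Arguments.
Unset Strict Implicit.
Unset Printing Implicit Defensive.

Import Order.TTheory GRing.Theory Num.Theory.
Import numFieldNormedType.Exports.

Local Open Scope classical_set_scope.
Local Open Scope ring_scope.

(* Antisymmetry is not required. *)
Record directed_set (I : Type) (le : I -> I -> Prop) : Prop := DirectedSet {
  dir_inhabited : exists i : I, True;
  dir_refl : forall i, le i i;
  dir_trans : forall i j k, le i j -> le j k -> le i k;
  dir_ub : forall i j, exists k, le i k /\ le j k }.

Definition tail (I : Type) (le : I -> I -> Prop) (a : I) : set I :=
  [set b | le a b].

(* The sets containing some tail: [y @ tails le --> l] is convergence of the
   net [y] to [l]. *)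
Definition tails (I : Type) (le : I -> I -> Prop) : set_system I :=
  filter_from [set: I] (tail le).

Definition net_liminf (R : realType) (I : Type) (le : I -> I -> Prop)
    (y : I -> R) : \bar R :=
  ereal_sup [set ereal_inf [set (y b)%:E | b in tail le a] | a in [set: I]].

Definition net_limsup (R : realType) (I : Type) (le : I -> I -> Prop)
    (y : I -> R) : \bar R :=
  ereal_inf [set ereal_sup [set (y b)%:E | b in tail le a] | a in [set: I]].

Definition convex_funs {R : realType} : set (R -> R) :=
  [set f | convex_function [set: convex_lmodType R^o] f].

(* The infimum is taken in [\bar R]: the real-valued [inf] of a set that is
   unbounded below is the junk value 0. *)
Definition argmin (R : realType) (f : R -> R) : set R :=
  [set t | (f t)%:E = ereal_inf [set (f s)%:E | s in [set: R]]].

Definition classS {R : realType} : set (R -> R) :=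
  [set f | [/\ convex_funs f, argmin f !=set0 &
               (-oo < ereal_inf [set t%:E | t in argmin f])%E]].

Definition classS' {R : realType} : set (R -> R) :=
  [set f | [/\ convex_funs f, argmin f !=set0 &
               (ereal_sup [set t%:E | t in argmin f] < +oo)%E]].

Definition classSu {R : realType} : set (R -> R) :=
  [set f | convex_funs f /\ exists! t, argmin f t].

(* The least, resp. greatest, element of [argmin f]; the default 0 is only
   returned when there is none. *)
Definition sigma (R : realType) (f : R -> R) : R :=
  xget 0 (argmin f `&` lbound (argmin f)).

Definition tau (R : realType) (f : R -> R) : R :=
  xget 0 (argmin f `&` ubound (argmin f)).

(* Main.v *)
Require Import Defs.
From HB Require Import structures.
From mathcomp Require Import all_boot all_order all_algebra.
From mathcomp Require Import all_classical all_reals all_analysis.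
From mathcomp Require Import lra.

Import Order.TTheory GRing.Theory Num.Theory.
Import numFieldNormedType.Exports.

Local Open Scope classical_set_scope.
Local Open Scope ring_scope.

(** Let [t < sigma f]. Then [f (sigma f) < f t], and this single strict
    inequality between two values survives, by pointwise convergence, for all
    [F a] with [a] large. But a convex function that is smaller at [m] than at
    some [t < m] decreases strictly up to [t], so none of its minimizers is
    [<= t] ([convex_argmin_gt]); hence [t < sigma (F a)] eventually
    ([near_sigma_gt]), which is the lower bound on the limit inferior.

    This uses that [sigma] is attained: a convex function cannot jump at the
    infimum of its minimizers, so this infimum is again a minimizer
    ([convex_argmin_inf]).

    The claims about [tau] follow by the reflection [x |-> - x], which exchanges
    least and greatest minimizers. When [f] has a unique minimizer, both claims
    apply, and the net is squeezed by [sigma (F a) <= tau (F a)]. *)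

(** * Convex functions of a real variable and their minimizers *)

Lemma convex_funsE (R : realType) (f : R -> R) (p x y : R) :
  convex_funs f -> 0 <= p -> p <= 1 ->
  f (p * x + (1 - p) * y) <= p * f x + (1 - p) * f y.
Proof.
by move=> fconv p0 p1; apply: (fconv (Itv01 p0 p1) x y); rewrite in_setT.
Qed.

(** Multiplying the chord inequality by [y - x] makes it linear in the values
    of [f], and lets [x = y] through. *)
Lemma convex_chord (R : realType) (f : R -> R) (x z y : R) :
  convex_funs f -> x <= z -> z <= y ->
  (y - x) * f z <= (y - z) * f x + (z - x) * f y.
Proof.
move=> fconv xz zy; have [xy|yx] := ltP x y; last first.
  have -> : z = x by lra.
  have -> : y = x by lra.
  by lra.
have d0 : 0 < y - x by lra.
have [p [p0 p1 pE]] : exists p, [/\ 0 <= p, p <= 1 & p * (y - x) = y - z].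
  exists ((y - z) / (y - x)); split; last by rewrite divfK// gt_eqF.
    by rewrite divr_ge0//; lra.
  by rewrite ler_pdivrMr//; lra.
have -> : z = p * x + (1 - p) * y by lra.
apply: le_trans (ler_wpM2l (ltW d0) (convex_funsE R f p x y fconv p0 p1)) _.
by nra.
Qed.

Lemma argminP (R : realType) (f : R -> R) (t : R) :
  argmin f t <-> forall s, f t <= f s.
Proof.
rewrite /argmin/=; split=> [fE s|fle].
  by rewrite -lee_fin fE; apply: ereal_inf_lbound; exists s.
apply/eqP; rewrite eq_le; apply/andP; split.
  by apply: le_ereal_inf_tmp => _ [s _ <-]; rewrite lee_fin.
by apply: ereal_inf_lbound; exists t.
Qed.

(** Otherwise [s <= t < m], and [f t] lies under the chord of [s] and [m], at
    whose endpoints [f] is at most [f m]. *)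
Lemma convex_argmin_gt (R : realType) (f : R -> R) (s t m : R) :
  convex_funs f -> t < m -> f m < f t -> argmin f s -> t < s.
Proof.
move=> fconv tm fmt /argminP fs; rewrite ltNge; apply/negP => st.
have := convex_chord R f s t m fconv st (ltW tm); have := fs m; nra.
Qed.

(** If minimizers [a] tend to [m] from the right, the chord inequality on
    [m - 1 <= m <= a] keeps [f m] from exceeding the minimum by more than a
    multiple of [a - m]. *)
Lemma convex_argmin_inf (R : realType) (f : R -> R) :
  convex_funs f -> has_inf (argmin f) -> argmin f (inf (argmin f)).
Proof.
move=> fconv finf; set m := inf _.
have [a0 fa0] : argmin f !=set0 by case: finf.
suff fm : f m <= f a0.
  by apply/argminP => s; apply: le_trans fm _; move/argminP : fa0; apply.
rewrite leNgt; apply/negP => gap.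
set K := `|f (m - 1) - f m| + 1.
have K0 : 0 < K by rewrite ltr_wpDl.
(* The chord bounds the gap [f m - f a0] by [(a - m) * K]. *)
have e0 : 0 < (f m - f a0) / K by rewrite divr_gt0// subr_gt0.
have [a fa] := inf_adherent e0 finf; rewrite -/m -ltrBlDl ltr_pdivlMr// => aK.
have ma : m <= a by apply: ge_inf => //; case: finf.
have /argminP/(_ a0) faa0 := fa.
have m1 : m - 1 <= m by lra.
have := convex_chord R f (m - 1) m a fconv m1 ma.
have := ler_norm (f (m - 1) - f m); rewrite /K in aK; nra.
Qed.

Lemma sigmaP (R : realType) (f : R -> R) :
  classS f -> argmin f (sigma f) /\ lbound (argmin f) (sigma f).
Proof.
move=> [fconv f0 flb]; apply: (@xgetPex _ 0 (argmin f `&` lbound (argmin f))).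
have flbound : has_lbound (argmin f).
  have lb t : argmin f t -> (ereal_inf [set t%:E | t in argmin f] <= t%:E)%E.
    by move=> ft; apply: ereal_inf_lbound; exists t.
  case: f0 => t0 /lb; case: (ereal_inf _) flb lb => [r _ lb _| |]//.
  by exists r => t /lb; rewrite lee_fin.
exists (inf (argmin f)); split; first exact: convex_argmin_inf.
by move=> t ft; exact: ge_inf.
Qed.

(** * Reflection *)

Lemma convex_funs_reflect (R : realType) (f : R -> R) :
  convex_funs f -> convex_funs (f \o -%R).
Proof.
move=> fconv p x y _ _; have := fconv p (- x) (- y).
rewrite !in_setT => /(_ isT isT) /=.
by rewrite (convN (x : R^o) (y : R^o) p).
Qed.

Lemma argmin_reflect (R : realType) (f : R -> R) (t : R) :
  argmin (f \o -%R) t <-> argmin f (- t).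
Proof.
rewrite !argminP; split=> ft s /=; last exact: ft.
by have := ft (- s); rewrite /= opprK.
Qed.

Lemma classS_reflect (R : realType) (f : R -> R) :
  classS' f -> classS (f \o -%R).
Proof.
move=> [fconv [t0 ft0] fub]; split.
- exact: convex_funs_reflect.
- by exists (- t0); apply/argmin_reflect; rewrite opprK.
- rewrite ereal_infEN image_comp.
  suff -> : (-%E \o EFin) @` argmin (f \o -%R) = EFin @` argmin f.
    by rewrite lteNr.
  apply/seteqP; split=> _ [t ft <-] /=.
    by exists (- t); rewrite ?EFinN//; apply/argmin_reflect.
  by exists (- t); rewrite ?EFinN ?oppeK//; apply/argmin_reflect; rewrite opprK.
Qed.

Lemma tauP (R : realType) (f : R -> R) :
  classS' f -> argmin f (tau f) /\ ubound (argmin f) (tau f).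
Proof.
move=> /classS_reflect /sigmaP[/(argmin_reflect R f) fs lb];
apply: (@xgetPex _ 0 (argmin f `&` ubound (argmin f))).
exists (- sigma (f \o -%R)); split=> // t ft; rewrite lerNr.
by apply: lb; apply/argmin_reflect; rewrite opprK.
Qed.

Lemma tau_reflect (R : realType) (f : R -> R) :
  classS' f -> tau f = - sigma (f \o -%R).
Proof.
move=> fS; have [ft ub] := tauP R f fS.
have [/(argmin_reflect R f) fs lb] := sigmaP R _ (classS_reflect R f fS).
apply/eqP; rewrite eq_le ub// andbT lerNr.
by apply: lb; apply/argmin_reflect; rewrite opprK.
Qed.

Lemma classSuP (R : realType) (f : R -> R) :
  classSu f -> [/\ classS f, classS' f & sigma f = tau f].
Proof.
move=> [fconv [m [fm muniq]]].
have fE : argmin f = [set m].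
  by apply/seteqP; split=> [t /muniq ->//|t ->].
have fS : classS f.
  by split=> //; [exists m | rewrite fE image_set1 ereal_inf1 ltNyr].
have fS' : classS' f.
  by split=> //; [exists m | rewrite fE image_set1 ereal_sup1 ltry].
split=> //; have [/muniq <- _] := sigmaP R f fS.
by have [/muniq <- _] := tauP R f fS'.
Qed.

(** * Semicontinuity along a filter *)

Section Semicontinuity.
Context (R : realType) (I : Type) (G : set_system I) (FG : Filter G).
Variables (F : I -> R -> R) (f : R -> R).
Hypothesis Fcvg : forall x : R, F a x @[a --> G] --> f x.

Lemma near_sigma_gt (t : R) :
  (forall a, classS (F a)) -> classS f -> t < sigma f ->
  \forall a \near G, t < sigma (F a).
Proof.
move=> FS fS tsf; have [/argminP fmin lb] := sigmaP R f fS.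
have fst : f (sigma f) < f t.
  rewrite ltNge; apply/negP => ft; suff /lb : argmin f t by rewrite leNgt tsf.
  by apply/argminP => s; exact: le_trans (fmin s).
(* The midpoint separates the two values, so each of the two limits can be
   compared with a constant. *)
set c := (f (sigma f) + f t) / 2.
have sc : f (sigma f) < c by rewrite /c; lra.
have ct : c < f t by rewrite /c; lra.
have near_lt := @cvgr_lt _ _ _ FG _ _ (Fcvg (sigma f)) _ sc.
have near_gt := @cvgr_gt _ _ _ FG _ _ (Fcvg t) _ ct.
move: near_lt near_gt; apply: filterS2 => a Fsc Fct.
have [Fconv _ _] := FS a; have [Fmin _] := sigmaP R _ (FS a).
exact: convex_argmin_gt Fconv tsf (lt_trans Fsc Fct) Fmin.
Qed.

End Semicontinuity.

Lemma near_tau_lt (R : realType) (I : Type) (G : set_system I) (FG : Filter G)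
    (F : I -> R -> R) (f : R -> R) (t : R) :
  (forall x : R, F a x @[a --> G] --> f x) ->
  (forall a, classS' (F a)) -> classS' f -> tau f < t ->
  \forall a \near G, tau (F a) < t.
Proof.
move=> Fcvg FS fS; rewrite tau_reflect// ltrNl => tsf.
have FrS a := classS_reflect R _ (FS a).
have := near_sigma_gt R I G FG (fun a => F a \o -%R) (f \o -%R)
  (fun x => Fcvg (- x)) (- t) FrS (classS_reflect R f fS) tsf.
by apply: filterS => a; rewrite tau_reflect// ltrNl.
Qed.

(** * Nets *)

Lemma tails_filter (I : Type) (le : I -> I -> Prop) :
  directed_set le -> Filter (tails le).
Proof.
move=> [[i _] _ letr ub]; apply: filter_from_filter; first by exists i.
move=> a b _ _; have [c [ac bc]] := ub a b; exists c => // d cd.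
by split; [exact: letr ac cd | exact: letr bc cd].
Qed.

Lemma le_net_liminf (R : realType) (I : Type) (le : I -> I -> Prop)
    (y : I -> R) (t : R) :
  (\forall a \near tails le, t <= y a) -> (t%:E <= net_liminf le y)%E.
Proof.
move=> [a _ ay].
apply: (@le_trans _ _ (ereal_inf [set (y b)%:E | b in tail le a])).
  by apply: le_ereal_inf_tmp => _ [b ab <-]; rewrite lee_fin; exact: ay.
by apply: ereal_sup_ubound; exists a.
Qed.

Lemma net_limsup_le (R : realType) (I : Type) (le : I -> I -> Prop)
    (y : I -> R) (t : R) :
  (\forall a \near tails le, y a <= t) -> (net_limsup le y <= t%:E)%E.
Proof.
move=> [a _ ay].
apply: (@le_trans _ _ (ereal_sup [set (y b)%:E | b in tail le a])).
  by apply: ereal_inf_lbound; exists a.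
by apply: ge_ereal_sup => _ [b ab <-]; rewrite lee_fin; exact: ay.
Qed.

Theorem corollary2 (R : realType) (I : Type) (le : I -> I -> Prop)
    (Idir : directed_set le) (F : I -> R -> R) (f : R -> R)
    (Fconvex : forall a, convex_funs (F a))
    (Fcvg : forall x : R, F a x @[a --> tails le] --> f x) :
  [/\ (forall a, classS (F a)) -> classS f ->
        ((sigma f)%:E <= net_liminf le (fun a => sigma (F a)))%E,
      (forall a, classS' (F a)) -> classS' f ->
        (net_limsup le (fun a => tau (F a)) <= (tau f)%:E)%E
    & (forall a, (classS `&` classS') (F a)) -> classSu f ->
        [/\ sigma (F a) @[a --> tails le] --> sigma f,
            tau (F a) @[a --> tails le] --> tau f
          & sigma f = tau f]].
Proof.
have FG := tails_filter I le Idir; split.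
- move=> FS fS; apply/lee_subgt0Pr => e e0; rewrite -EFinB.
  apply: le_net_liminf; have lt_e : sigma f - e < sigma f by lra.
  have := near_sigma_gt R I _ FG F f Fcvg _ FS fS lt_e.
  by apply: filterS => a /ltW.
- move=> FS fS; apply/lee_addgt0Pr => e e0; rewrite -EFinD.
  apply: net_limsup_le; have lt_e : tau f < tau f + e by lra.
  have := near_tau_lt R I _ FG F f _ Fcvg FS fS lt_e.
  by apply: filterS => a /ltW.
- move=> FSS' /classSuP[fS fS' st].
  have FS a : classS (F a) by case: (FSS' a).
  have FS' a : classS' (F a) by case: (FSS' a).
  have squeeze e : 0 < e ->
      \forall a \near tails le, [/\ sigma f - e < sigma (F a),
        sigma (F a) <= tau (F a) & tau (F a) < sigma f + e].
    move=> e0.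
    have lt_s : sigma f - e < sigma f by lra.
    have lt_t : tau f < sigma f + e by rewrite st; lra.
    have near_s := near_sigma_gt R I _ FG F f Fcvg _ FS fS lt_s.
    have near_t := near_tau_lt R I _ FG F f _ Fcvg FS' fS' lt_t.
    move: near_s near_t; apply: filterS2 => a s_lt t_lt; split=> //.
    have [Fs _] := sigmaP R _ (FS a).
    by have [_ ub] := tauP R _ (FS' a); exact: ub.
  split=> //; apply/cvgrPdist_lt => e /squeeze.
  + by apply: filterS => a [*]; rewrite ltr_norml; apply/andP; split; lra.
  + rewrite -st; apply: filterS => a [*].
    by rewrite ltr_norml; apply/andP; split; lra.
Qed.
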